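(* Let $Q$ be a manifold, $\mathcal{D}$ a regular distribution on $Q$ whose annihilator $\mathcal{D}^{\circ}$ is locally generated by independent $1$-forms $\Phi^a=\Phi^a_i\,\mathrm{d}q^i$, let $H:T^*Q\times\mathbb{R}\to\mathbb{R}$ be smooth and let $M\subseteq T^*Q\times\mathbb{R}$ be a constraint (embedded) submanifold locally given by $M=\{\varphi^a=0\ \forall a\}$ for constraint functions $\varphi^a$. Let $\mathfrak{D}^l$ be the distribution on $T^*Q\times\mathbb{R}$ with $(\mathfrak{D}^l)^{\circ}=(\pi_{Q,\mathbb{R}})^*\mathcal{D}^{\circ}$. Let $X$ be a vector field on $T^*Q\times\mathbb{R}$ satisfying $$\flat_Q(X)-\mathrm{d}H+(H+\mathcal{R}_Q(H))\,\eta_Q\in(\mathfrak{D}^l)^{\circ}\ \text{ along }M,\qquad X|_M\in\mathfrak{X}(M).$$ Then the integral curves $\xi(t)=(q^i(t),p_i(t),z(t))$ of $X$ in $M$ are solutions of the constrained Hamiltonian Herglotz equations: for some multipliers $\lambda_a$, $$\begin{cases}\dfrac{\mathrm{d}q^i}{\mathrm{d}t}=\dfrac{\partial H}{\partial p_i},\\[2mm] \dfrac{\mathrm{d}p_i}{\mathrm{d}t}=-\dfrac{\partial H}{\partial q^i}-p_i\dfrac{\partial H}{\partial z}-\lambda_a\Phi^a_i,\\[2mm] \dfrac{\mathrm{d}z}{\mathrm{d}t}=p_i\dfrac{\partial H}{\partial p_i}-H,\\[2mm] \varphi^a(\xi(t))=0\quad\text{for all }a.\end{cases}$$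
   Context: $T^*Q\times\mathbb{R}$ carries canonical coordinates $(q^i,p_i,z)$, the canonical contact form $\eta_Q=\mathrm{d}z-p_i\,\mathrm{d}q^i$ and Reeb vector field $\mathcal{R}_Q=\partial/\partial z$. $\flat_Q(v)=\iota_v\mathrm{d}\eta_Q+\eta_Q(v)\eta_Q$ is a vector bundle isomorphism $T(T^*Q\times\mathbb{R})\to T^*(T^*Q\times\mathbb{R})$. $\pi_{Q,\mathbb{R}}:T^*Q\times\mathbb{R}\to Q$ is the projection $(\alpha_q,z)\mapsto q$; thus $(\mathfrak{D}^l)^{\circ}$ is generated by the forms $\Phi^a_i\,\mathrm{d}q^i$ regarded on $T^*Q\times\mathbb{R}$. Superscript $\circ$ is the annihilator. Repeated indices are summed. *)

(* Defs.v *)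
(* Smooth manifolds are sets with a smooth atlas; the topology is the one
   induced by the atlas.  Tensors at a point are families of components, one
   for each chart around the point, related by the usual transformation law.
   A tensor equation is required in every chart around the point. *)
From HB Require Import structures.
From mathcomp Require Import all_boot all_order all_algebra.
From mathcomp Require Import all_classical all_reals all_analysis.
Set Implicit Arguments.
Unset Strict Implicit.
Unset Printing Implicit Defensive.
Import Order.TTheory GRing.Theory Num.Theory.
Import numFieldNormedType.Exports.
Local Open Scope classical_set_scope.
Local Open Scope ring_scope.

(* C^k through iterated directional derivatives; used on open subsets of
   finite-dimensional spaces only, where it is the usual notion. *)
Fixpoint Ck (R : realType) (E F : normedModType R) (k : nat)
    (U : set E) (f : E -> F) : Prop :=
  match k with
  | 0%N => forall x, U x -> {for x, continuous f}
  | k'.+1 => (forall x, U x -> differentiable f x) /\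
             (forall v : E, Ck k' U (fun x => 'D_v f x))
  end.

Definition smooth (R : realType) (E F : normedModType R)
    (U : set E) (f : E -> F) : Prop := forall k, Ck k U f.

Record chart (R : realType) (T : Type) (E : normedModType R) := Chart {
  chart_dom : set T;
  chart_coord : T -> E
}.

(* The inverse of the chart c; the value is x outside the image of c. *)
Definition chart_inv (R : realType) (T : Type) (E : normedModType R)
    (c : chart T E) (x : T) : E -> T :=
  'pinv_(fun=> x) (chart_dom c) (chart_coord c).

Definition chart_at (R : realType) (T : Type) (E : normedModType R)
    (A : set (chart T E)) (x : T) : set (chart T E) :=
  [set c | A c /\ chart_dom c x].

Definition smooth_atlas (R : realType) (T : Type) (E : normedModType R)
    (A : set (chart T E)) : Prop :=
  [/\ forall x, exists c, chart_at A x c,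
      forall c, A c -> set_inj (chart_dom c) (chart_coord c),
      forall c c', A c -> A c' ->
        open (chart_coord c @` (chart_dom c `&` chart_dom c')) &
      forall c c' x, chart_at A x c -> chart_at A x c' ->
        smooth (chart_coord c @` (chart_dom c `&` chart_dom c'))
          (chart_coord c' \o chart_inv c x)].

Definition mopen (R : realType) (T : Type) (E : normedModType R)
    (A : set (chart T E)) (U : set T) : Prop :=
  forall c, A c -> open (chart_coord c @` (U `&` chart_dom c)).

Definition mhausdorff (R : realType) (T : Type) (E : normedModType R)
    (A : set (chart T E)) : Prop :=
  forall x y : T, x <> y -> exists U V : set T,
    [/\ mopen A U, mopen A V, U x, V y & U `&` V = set0].

Definition msecond_countable (R : realType) (T : Type) (E : normedModType R)
    (A : set (chart T E)) : Prop :=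
  exists B : nat -> set T, (forall m, mopen A (B m)) /\
    forall U, mopen A U -> forall x, U x -> exists m, B m x /\ B m `<=` U.

Record manifold (R : realType) (n : nat) := Manifold {
  pt :> Type;
  atlas : set (chart pt 'rV[R]_n);
  atlasP : smooth_atlas atlas;
  hausdorffP : mhausdorff atlas;
  second_countableP : msecond_countable atlas
}.
Arguments atlas {R n} m.

(* Smoothness on U of a field whose component in the chart c is f c. *)
Definition smooth_rep (R : realType) (T : Type) (E F : normedModType R)
    (A : set (chart T E)) (U : set T) (f : chart T E -> T -> F) : Prop :=
  forall c x, A c -> (U `&` chart_dom c) x ->
    smooth (chart_coord c @` (U `&` chart_dom c)) (f c \o chart_inv c x).

Definition smooth_fun (R : realType) (T : Type) (E F : normedModType R)
    (A : set (chart T E)) (U : set T) (f : T -> F) : Prop :=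
  smooth_rep A U (fun=> f).

(* The value on charts that are not around x is normalised to 0, so that equal
   vectors have equal families of components (likewise for covectors). *)
Record tvec (R : realType) (T : Type) (E : normedModType R)
    (A : set (chart T E)) (x : T) := Tvec {
  tv :> chart T E -> E;
  tvP : forall c c', chart_at A x c -> chart_at A x c' ->
    tv c' = 'd (chart_coord c' \o chart_inv c x) (chart_coord c x) (tv c);
  tv0 : forall c, ~ chart_at A x c -> tv c = 0
}.

Definition smooth_vfield (R : realType) (T : Type) (E : normedModType R)
    (A : set (chart T E)) (X : forall x, tvec A x) : Prop :=
  smooth_rep A setT (fun c x => X x c).

Definition has_velocity (R : realType) (T : Type) (E : normedModType R)
    (A : set (chart T E)) (g : R -> T) (t : R) (v : chart T E -> E) : Prop :=
  forall c, chart_at A (g t) c ->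
    (\forall s \near t, chart_dom c (g s)) /\
    is_derive t 1 (chart_coord c \o g) (v c).

Definition integral_curve (R : realType) (T : Type) (E : normedModType R)
    (A : set (chart T E)) (X : forall x, tvec A x) (J : set R) (g : R -> T) :
    Prop :=
  forall t, J t -> has_velocity A g t (X (g t)).

Definition tangent_to (R : realType) (T : Type) (E : normedModType R)
    (A : set (chart T E)) (M : set T) (x : T) (v : tvec A x) : Prop :=
  exists g : R -> T,
    [/\ g 0 = x, \forall s \near 0, M (g s) & has_velocity A g 0 v].

(* A covector-valued expression is handled through its value on a tangent
   vector with components v in the chart c, as a function of c and v. *)
Definition dfun (R : realType) (T : Type) (E : normedModType R)
    (f : T -> R) (x : T) (c : chart T E) (v : E) : R :=
  'd (f \o chart_inv c x) (chart_coord c x) v.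

Definition dform (R : realType) (T : Type) (E : normedModType R)
    (w : T -> chart T E -> E -> R) (x : T) (c : chart T E) (u v : E) : R :=
  'D_u (fun y => w (chart_inv c x y) c v) (chart_coord c x) -
  'D_v (fun y => w (chart_inv c x y) c u) (chart_coord c x).

Definition constraint_functions (R : realType) (T : Type)
    (E : normedModType R) (A : set (chart T E)) (M U : set T) (r : nat)
    (phi : 'I_r -> T -> R) : Prop :=
  [/\ mopen A U, forall a, smooth_fun A U (phi a) &
      forall x, U x -> (M x <-> forall a, phi a x = 0)].

Definition embedded_submanifold (R : realType) (T : Type)
    (E : normedModType R) (A : set (chart T E)) (r : nat) (M : set T) : Prop :=
  forall x, M x -> exists (U : set T) (phi : 'I_r -> T -> R),
    [/\ U x, constraint_functions A M U phi &
        forall y, (M `&` U) y -> forall mu : 'I_r -> R,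
          (forall c v, chart_at A y c ->
             \sum_a mu a * dfun (phi a) y c v = 0) ->
          forall a, mu a = 0].

Definition pairing (R : realType) (n : nat) (p v : 'rV[R]_n) : R :=
  \sum_i p 0 i * v 0 i.

Record covec (R : realType) (n : nat) (Q : manifold R n) (q : Q) := Covec {
  cv :> chart Q 'rV[R]_n -> 'rV[R]_n;
  cvP : forall c c', chart_at (atlas Q) q c ->
    chart_at (atlas Q) q c' -> forall v,
    pairing (cv c) v =
    pairing (cv c') ('d (chart_coord c' \o chart_inv c q) (chart_coord c q) v);
  cv0 : forall c, ~ chart_at (atlas Q) q c -> cv c = 0
}.

Definition tdistribution (R : realType) (n : nat) (Q : manifold R n) :=
  forall q : Q, set (tvec (atlas Q) q).

Definition is_subspace (R : realType) (n : nat) (Q : manifold R n) (q : Q)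
    (S : set (tvec (atlas Q) q)) : Prop :=
  S !=set0 /\ forall (a : R) (u v w : tvec (atlas Q) q), S u -> S v ->
    (forall c, w c = a *: u c + v c) -> S w.

Definition annihilator (R : realType) (n : nat) (Q : manifold R n)
    (D : tdistribution Q) (q : Q) : set (covec q) :=
  [set alpha | forall v, D q v ->
     forall c, chart_at (atlas Q) q c -> pairing (alpha c) (v c) = 0].

(* The 1-forms Phi a are smooth and independent on W and generate there the
   annihilator of D; Phi a q c 0 i is the component of dq^i. *)
Definition annihilator_frame (R : realType) (n : nat) (Q : manifold R n)
    (k : nat) (D : tdistribution Q) (W : set Q)
    (Phi : 'I_k -> forall q : Q, covec q) : Prop :=
  [/\ mopen (atlas Q) W,
      forall a, smooth_rep (atlas Q) W (fun c q => Phi a q c),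
      forall q, W q -> forall mu : 'I_k -> R,
        (forall c, \sum_a mu a *: Phi a q c = 0) -> forall a, mu a = 0 &
      forall q, W q -> forall alpha : covec q, annihilator D alpha <->
        exists mu : 'I_k -> R, forall c, alpha c = \sum_a mu a *: Phi a q c].

(* k is the corank of D. *)
Definition regular_distribution (R : realType) (n : nat) (Q : manifold R n)
    (k : nat) (D : tdistribution Q) : Prop :=
  (forall q, is_subspace (D q)) /\
  forall q : Q, exists (W : set Q) (Phi : 'I_k -> forall q : Q, covec q),
    W q /\ annihilator_frame D W Phi.

(* The extended phase space T*Q x R. *)
Record phase (R : realType) (n : nat) (Q : manifold R n) := Phase {
  base : Q;
  mom : covec base;
  zco : R
}.

Definition phase_model (R : realType) (n : nat) : normedModType R :=
  ('rV[R]_n * 'rV[R]_n * R)%type.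

(* The canonical coordinates (q^i, p_i, z) induced by a chart of Q. *)
Definition canonical_chart (R : realType) (n : nat) (Q : manifold R n)
    (c : chart Q 'rV[R]_n) : chart (phase Q) (phase_model R n) :=
  {| chart_dom := [set x | chart_dom c (base x)];
     chart_coord := fun x => (chart_coord c (base x), mom x c, zco x) |}.

Definition phase_atlas (R : realType) (n : nat) (Q : manifold R n) :
    set (chart (phase Q) (phase_model R n)) :=
  (@canonical_chart R n Q) @` atlas Q.
Arguments phase_atlas {R n} Q.

Definition contact_form (R : realType) (n : nat) (Q : manifold R n)
    (x : phase Q) (c : chart (phase Q) (phase_model R n))
    (v : phase_model R n) : R :=
  v.2 - pairing (chart_coord c x).1.2 v.1.1.

Definition flat (R : realType) (n : nat) (Q : manifold R n) (x : phase Q)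
    (v : tvec (phase_atlas Q) x)
    (c : chart (phase Q) (phase_model R n)) (w : phase_model R n) : R :=
  dform (@contact_form R n Q) x c (v c) w +
  contact_form x c (v c) * contact_form x c w.

Definition Dq (R : realType) (n : nat) (i : 'I_n) : phase_model R n :=
  (delta_mx 0 i, 0, 0).
Definition Dp (R : realType) (n : nat) (i : 'I_n) : phase_model R n :=
  (0, delta_mx 0 i, 0).
Definition Dz (R : realType) (n : nat) : phase_model R n := (0, 0, 1).

Definition pderiv (R : realType) (n : nat) (Q : manifold R n)
    (H : phase Q -> R) (e : phase_model R n)
    (c : chart (phase Q) (phase_model R n)) (x : phase Q) : R :=
  'D_e (H \o chart_inv c x) (chart_coord c x).

(* The derivative of H along the Reeb field, which is d/dz in canonical
   coordinates. *)
Definition reeb (R : realType) (n : nat) (Q : manifold R n)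
    (H : phase Q -> R) (c : chart (phase Q) (phase_model R n))
    (x : phase Q) : R := pderiv H (Dz R n) c x.

(* The pullback of the annihilator of D by the projection (q, p, z) |-> q. *)
Definition pullback_annihilator (R : realType) (n : nat) (Q : manifold R n)
    (D : tdistribution Q) (x : phase Q) :
    set (chart (phase Q) (phase_model R n) -> phase_model R n -> R) :=
  [set beta | exists2 alpha : covec (base x), annihilator D alpha &
     forall c, chart_at (atlas Q) (base x) c ->
       forall v, beta (canonical_chart c) v = pairing (alpha c) v.1.1].

(* Main.v *)
Require Import Defs.
From HB Require Import structures.
From mathcomp Require Import all_boot all_order all_algebra.
From mathcomp Require Import all_classical all_reals all_analysis.
From mathcomp Require Import lra.
Set Implicit Arguments.
Unset Strict Implicit.
Unset Printing Implicit Defensive.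
Import Order.TTheory GRing.Theory Num.Theory.
Import numFieldNormedType.Exports.
Local Open Scope classical_set_scope.
Local Open Scope ring_scope.

(** The equation for X says that the one-form
      i_X d eta + eta(X) eta - dH + (H + H_z) eta
    is a combination of the forms Phi a, which only involve the dq^i.  Write
    a, b, s for the q-, p- and z-components of X in canonical coordinates.
    Since d eta = dq^i /\ dp_i, evaluating the form on the coordinate fields
    gives the following.
    - on d/dp_i:  a_i - H_(p_i) = 0, the equation for q;
    - on d/dz:    eta(X) - H_z + (H + H_z) = 0, that is eta(X) = - H; as
      eta(X) = s - p_i a_i, this is the equation for z;
    - on d/dq^i:  - b_i - H_(q^i) - p_i (eta(X) + H + H_z) = lambda_a Phi^a_i,
      the equation for p once eta(X) is replaced by - H.
    This is [herglotz_components].  An integral curve has X as its velocity, so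
    these are the equations of motion, with the multipliers chosen separately
    at each time; they do not depend on the chart because the Phi a are
    covectors.  The constraints hold since the curve stays in M.

    The one geometric point is the formula for d eta.  Differentiating the
    coefficients of eta requires that a neighbourhood of a point in the model
    space lies in the image of the canonical chart, so that every nearby triple
    (q, p, z) consists of the coordinates of a phase point.  This amounts to
    finding, over any point near the base, a covector with prescribed components
    in one chart ([exists_covec]); its components in the other charts are
    defined by pulling back along the transition maps, and their consistency is
    the chain rule for these maps ([transition_comp]). *)

(** * Directional derivatives and linear maps *)

Lemma is_derive_linear_comp (R : realType) (V E F : normedModType R)
    (l : {linear E -> F}) (f : V -> E) (x v : V) (df : E) :
  continuous l -> is_derive x v f df -> is_derive x v (l \o f) (l df).
Proof.
move=> l_cont [f_der <-].
(* l commutes with difference quotients, and continuity passes to the limit. *)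
have quot : (fun h : R => h^-1 *: ((l \o f) (h *: v + x) - (l \o f) x)) =
    l \o (fun h : R => h^-1 *: (f (h *: v + x) - f x)).
  by apply/funext => h; rewrite !compE (linearZ_LR l) (linearB l).
have quot_cvg : (fun h : R => h^-1 *: ((l \o f) (h *: v + x) - (l \o f) x))
    @ 0^' --> l ('D_v f x).
  by rewrite quot; apply: continuous_cvg; [exact: l_cont | exact: f_der].
apply: DeriveDef; first by apply/cvg_ex; exists (l ('D_v f x)).
exact: cvg_lim.
Qed.

(** The projections below extract the coordinates of the velocity of a curve
    and of a point of the model space. *)
Lemma is_derive_fst (R : realType) (V E F : normedModType R)
    (f : V -> E * F) (x v : V) (df : E * F) :
  is_derive x v f df -> is_derive x v (fun y => (f y).1) df.1.
Proof.
by apply: (@is_derive_linear_comp _ _ _ _ fst); move=> y; exact: cvg_fst.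
Qed.

Lemma is_derive_snd (R : realType) (V E F : normedModType R)
    (f : V -> E * F) (x v : V) (df : E * F) :
  is_derive x v f df -> is_derive x v (fun y => (f y).2) df.2.
Proof.
by apply: (@is_derive_linear_comp _ _ _ _ snd); move=> y; exact: cvg_snd.
Qed.

Lemma is_derive_entry (R : realType) (V : normedModType R) (m n : nat)
    (f : V -> 'M[R]_(m, n)) (x v : V) (df : 'M[R]_(m, n)) i j :
  is_derive x v f df -> is_derive x v (fun y => f y i j) (df i j).
Proof.
pose entry (A : 'M[R]_(m, n)) : R := A i j.
have entry_lin : linear entry by move=> a A B; rewrite /entry !mxE.
pose entryL := GRing.isLinear.Build R 'M[R]_(m, n) R *%R entry entry_lin.
pose l : {linear 'M[R]_(m, n) -> R} := HB.pack entry entryL.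
by apply: (@is_derive_linear_comp _ _ _ _ l); exact: coord_continuous.
Qed.

(** * The pairing of covectors with vectors *)

Section Pairing.
Variables (R : realType) (n : nat).
Implicit Types p v : 'rV[R]_n.

Lemma pairing_delta p i : pairing p (delta_mx 0 i) = p 0 i.
Proof.
rewrite /pairing (bigD1 i) //= mxE !eqxx mulr1 big1 ?addr0 // => j ji.
by rewrite mxE eqxx (negbTE ji) mulr0.
Qed.

Lemma delta_pairing v i : pairing (delta_mx 0 i) v = v 0 i.
Proof.
rewrite -pairing_delta /pairing; apply: eq_bigr => j _; exact: mulrC.
Qed.

Lemma pairing0r p : pairing p 0 = 0.
Proof. by rewrite /pairing big1 // => i _; rewrite mxE mulr0. Qed.

Lemma pairing0l v : pairing 0 v = 0.
Proof. by rewrite /pairing big1 // => i _; rewrite mxE mul0r. Qed.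

(** The row on the left is the transpose of L applied to p: the components of
    a covector after a change of coordinates with differential L. *)
Lemma pairing_pullback (L : {linear 'rV[R]_n -> 'rV[R]_n}) p v :
  pairing (\row_i pairing p (L (delta_mx 0 i))) v = pairing p (L v).
Proof.
rewrite [in RHS](row_sum_delta v) linear_sum /pairing.
under eq_bigr do rewrite mxE mulr_suml.
rewrite exchange_big; apply: eq_bigr => j _ /=.
rewrite summxE mulr_sumr; apply: eq_bigr => i _.
by rewrite linearZ mxE -mulrA; congr (_ * _); exact: mulrC.
Qed.

End Pairing.

(** * Transition maps of a smooth atlas *)

Section Transition.
Variables (R : realType) (T : Type) (E : normedModType R).
Variables (A : set (chart T E)) (A_atlas : smooth_atlas A).
Implicit Types (c : chart T E) (x y : T).

Lemma chart_invK x c e : (chart_coord c @` chart_dom c) e ->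
  chart_coord c (chart_inv c x e) = e.
Proof. by move=> e_im; apply: pinvK; rewrite inE. Qed.

Lemma chart_coordK x c y : A c -> chart_dom c y ->
  chart_inv c x (chart_coord c y) = y.
Proof.
move=> Ac cy; have [_ inj _ _] := A_atlas.
by apply: pinvKV; [exact: inj | rewrite inE].
Qed.

Lemma transition_image_nbhs c c' x : chart_at A x c -> chart_at A x c' ->
  nbhs (chart_coord c x) (chart_coord c @` (chart_dom c `&` chart_dom c')).
Proof.
move=> [Ac cx] [Ac' c'x]; have [_ _ op _] := A_atlas.
by apply: open_nbhs_nbhs; split; [exact: op | exists x].
Qed.

Lemma transition_differentiable c c' x : chart_at A x c -> chart_at A x c' ->
  differentiable (chart_coord c' \o chart_inv c x) (chart_coord c x).
Proof.
move=> cx c'x; have [_ _ _ sm] := A_atlas.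
have [+ _] := sm c c' x cx c'x 1%N; apply.
by case: cx c'x => _ cx [_ c'x]; exists x.
Qed.

(** The map is the identity only on the image of the chart, which contains a
    neighbourhood of the point; this suffices for its differential. *)
Lemma transition_id c x v : chart_at A x c ->
  'd (chart_coord c \o chart_inv c x) (chart_coord c x) v = v.
Proof.
move=> cx; rewrite -deriveE; last exact: transition_differentiable.
rewrite -[RHS](derive_id (chart_coord c x) v); apply: near_eq_derive.
near=> e; apply: chart_invK.
have [y [cy _] <-] : (chart_coord c @` (chart_dom c `&` chart_dom c)) e.
  near: e; exact: transition_image_nbhs.
by exists y.
Unshelve. all: by end_near. Qed.

(** The cocycle identity: near the coordinates of x, points lie in the domain
    of both c and c', where going through c' changes nothing, and the chain
    rule applies. *)
Lemma transition_comp c c' c'' x v :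
  chart_at A x c -> chart_at A x c' -> chart_at A x c'' ->
  'd (chart_coord c'' \o chart_inv c x) (chart_coord c x) v =
  'd (chart_coord c'' \o chart_inv c' x) (chart_coord c' x)
    ('d (chart_coord c' \o chart_inv c x) (chart_coord c x) v).
Proof.
move=> cx c'x c''x.
have inv_x : chart_inv c x (chart_coord c x) = x.
  by apply: chart_coordK; case: cx.
have d1 := transition_differentiable cx c'x.
have d2 : differentiable (chart_coord c'' \o chart_inv c' x)
    ((chart_coord c' \o chart_inv c x) (chart_coord c x)).
  by rewrite /= inv_x; exact: transition_differentiable.
have := diff_comp d1 d2; move=> /(congr1 (fun g => g v)) /=.
rewrite inv_x => <-.
rewrite -deriveE; last exact: transition_differentiable.
rewrite -deriveE; last exact: differentiable_comp.
apply: near_eq_derive; near=> e.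
have [y [cy c'y] <-] : (chart_coord c @` (chart_dom c `&` chart_dom c')) e.
  near: e; exact: transition_image_nbhs.
have [[Ac _] [Ac' _]] := (cx, c'x).
by rewrite /= (chart_coordK x Ac cy) (chart_coordK x Ac' c'y).
Unshelve. all: by end_near. Qed.

End Transition.

(** * Canonical charts and the contact form *)

Section Phase.
Variables (R : realType) (n : nat) (Q : manifold R n).
Implicit Types (c : chart Q 'rV[R]_n) (x : phase Q).

(** In a chart c', the components are those of p pulled back along the
    transition map from c' to c. *)
Lemma exists_covec (q : Q) c (p : 'rV[R]_n) : chart_at (atlas Q) q c ->
  exists alpha : covec q, alpha c = p.
Proof.
move=> cq.
pose L c' := 'd (chart_coord c \o chart_inv c' q) (chart_coord c' q).
have [a aE a0] : exists2 a : chart Q 'rV[R]_n -> 'rV[R]_n,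
    forall c' v, chart_at (atlas Q) q c' ->
      pairing (a c') v = pairing p (L c' v) &
    forall c', ~ chart_at (atlas Q) q c' -> a c' = 0.
  exists (fun c' => if `[< chart_at (atlas Q) q c' >]
    then \row_i pairing p (L c' (delta_mx 0 i)) else 0).
    by move=> c' v c'q; rewrite asboolT // pairing_pullback.
  by move=> c' c'q; rewrite asboolF.
have a_tr c1 c2 : chart_at (atlas Q) q c1 -> chart_at (atlas Q) q c2 ->
    forall v, pairing (a c1) v =
    pairing (a c2) ('d (chart_coord c2 \o chart_inv c1 q) (chart_coord c1 q) v).
  move=> c1q c2q v; rewrite (aE c1 v c1q) (aE c2 _ c2q); congr (pairing p _).
  exact: (transition_comp (atlasP Q) v c1q c2q cq).
exists (Covec a_tr a0) => /=; apply/rowP => i.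
by rewrite -pairing_delta aE // /L (transition_id (atlasP Q)) // pairing_delta.
Qed.

(** The image of the canonical chart is the image of c times the whole space
    of pairs (p, z), by [exists_covec]; hence it is a neighbourhood of each of
    its points. *)
Lemma canonical_chart_inv_near x c : chart_at (atlas Q) (base x) c ->
  \forall y \near chart_coord (canonical_chart c) x,
    chart_coord (canonical_chart c) (chart_inv (canonical_chart c) x y) = y.
Proof.
move=> cx.
have near_q : \forall y \near chart_coord (canonical_chart c) x,
    (chart_coord c @` (chart_dom c `&` chart_dom c)) y.1.1.
  have fst2 : (fun y : phase_model R n => y.1.1)
      @ (chart_coord (canonical_chart c) x) --> chart_coord c (base x).
    apply: (@cvg_comp _ _ _ fst fst); [exact: cvg_fst | exact: cvg_fst].
  exact: fst2 (transition_image_nbhs (atlasP Q) cx cx).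
near=> y; apply: chart_invK.
have [q [cq _] qy] :
    (chart_coord c @` (chart_dom c `&` chart_dom c)) y.1.1 by near: y.
have [alpha alphaE] : exists alpha : covec q, alpha c = y.1.2.
  by apply: exists_covec; split => //; case: cx.
exists (Phase alpha y.2) => //=.
by rewrite alphaE qy -!surjective_pairing.
Unshelve. all: by end_near. Qed.

(** In coordinates, eta(v) at (q, p, z) is v_z - p_i v^i, an affine function
    whose linear part only involves p. *)
Lemma derive_contact_form x c (u v : phase_model R n) :
  chart_at (atlas Q) (base x) c ->
  'D_u (fun y => contact_form (chart_inv (canonical_chart c) x y)
                   (canonical_chart c) v)
    (chart_coord (canonical_chart c) x) = - pairing u.1.2 v.1.1.
Proof.
move=> cx.
pose f (y : phase_model R n) : R := v.2 - pairing y.1.2 v.1.1.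
rewrite (@near_eq_derive _ _ _ _ f); last first.
  near=> y; rewrite /contact_form /f.
  by congr (_ - pairing _.1.2 _); near: y; exact: canonical_chart_inv_near.
set y0 := chart_coord _ x.
have fE : f =
    cst v.2 - \sum_i (fun y : phase_model R n => v.1.1 0 i *: y.1.2 0 i).
  apply/funext => y; rewrite /f /= !fctE; congr (_ - _).
  by rewrite fct_sumE; apply: eq_bigr => i _; exact: mulrC.
have entry_der i :
    is_derive y0 u (fun y : phase_model R n => y.1.2 0 i) (u.1.2 0 i).
  by apply/is_derive_entry/is_derive_snd/is_derive_fst.
have fD : is_derive y0 u f (0 - \sum_i v.1.1 0 i *: u.1.2 0 i).
  by rewrite fE; apply: is_deriveB.
rewrite derive_val sub0r; congr (- _); apply: eq_bigr => i _; exact: mulrC.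
Unshelve. all: by end_near. Qed.

(** The first two terms are d eta (X, w) for d eta = dq^i /\ dp_i. *)
Lemma flatE x (X : tvec (phase_atlas Q) x) c (w : phase_model R n)
    (e := canonical_chart c) :
  chart_at (atlas Q) (base x) c ->
  flat X e w = pairing w.1.2 (X e).1.1 - pairing (X e).1.2 w.1.1
               + contact_form x e (X e) * contact_form x e w.
Proof.
move=> cx; rewrite /flat /dform !derive_contact_form //.
by rewrite opprK [_ + pairing _ _]addrC.
Qed.

Lemma dfunE (H : phase Q -> R) x c (v : phase_model R n) :
  smooth_fun (phase_atlas Q) setT H ->
  chart_at (atlas Q) (base x) c ->
  dfun H x (canonical_chart c) v = pderiv H v (canonical_chart c) x.
Proof.
move=> H_smooth [Ac cx]; rewrite /dfun /pderiv deriveE //.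
have ecx : (setT `&` chart_dom (canonical_chart c)) x by [].
have Ae : phase_atlas Q (canonical_chart c) by exists c.
have [+ _] := H_smooth _ _ Ae ecx 1%N; apply; by exists x.
Qed.

(** The constraint force alpha only sees the q-part of a test vector: testing
    on the p- and z-directions gives unconstrained equations, and alpha enters
    only the equation for the momenta. *)
Lemma herglotz_components (H : phase Q -> R) x (X : tvec (phase_atlas Q) x) c
    (alpha : 'rV[R]_n) (e := canonical_chart c) :
  smooth_fun (phase_atlas Q) setT H -> chart_at (atlas Q) (base x) c ->
  (forall w, flat X e w - dfun H x e w + (H x + reeb H e x) * contact_form x e w
             = pairing alpha w.1.1) ->
  [/\ forall i, (X e).1.1 0 i = pderiv H (Dp R i) e x,
      forall i, (X e).1.2 0 i =
        - pderiv H (Dq R i) e x - mom x c 0 i * pderiv H (Dz R n) e x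
        - alpha 0 i &
      (X e).2 = \sum_i mom x c 0 i * pderiv H (Dp R i) e x - H x].
Proof.
move=> H_smooth cx eqn.
have eqn' w : pairing w.1.2 (X e).1.1 - pairing (X e).1.2 w.1.1
    + contact_form x e (X e) * contact_form x e w - pderiv H w e x
    + (H x + pderiv H (Dz R n) e x) * contact_form x e w = pairing alpha w.1.1.
  by rewrite -eqn flatE // dfunE.
have etaE (w : phase_model R n) :
    contact_form x e w = w.2 - pairing (mom x c) w.1.1 by [].
have qE i : (X e).1.1 0 i = pderiv H (Dp R i) e x.
  have := eqn' (Dp R i); rewrite (etaE (Dp R i)) /= !pairing0r delta_pairing.
  lra.
(* The two occurrences of H_z cancel on d/dz, leaving eta(X) = - H. *)
have hE : contact_form x e (X e) = - H x.
  have := eqn' (Dz R n); rewrite (etaE (Dz R n)) /= !pairing0r pairing0l.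
  lra.
split => // [i|].
  have := eqn' (Dq R i); rewrite hE (etaE (Dq R i)) /=
    !pairing0l !pairing_delta.
  lra.
move: hE; rewrite etaE /pairing.
under eq_bigr do rewrite qE.
lra.
Qed.

End Phase.

(** * The constrained Herglotz equations *)

Theorem theorem13 (R : realType) (n k r : nat) (Q : manifold R n)
    (D : tdistribution Q) (H : phase Q -> R) (M : set (phase Q))
    (X : forall x : phase Q, tvec (phase_atlas Q) x)
    (D_reg : regular_distribution k D)
    (H_smooth : smooth_fun (phase_atlas Q) setT H)
    (M_sub : embedded_submanifold (phase_atlas Q) r M)
    (X_smooth : smooth_vfield X)
    (X_eq : forall x, M x ->
       pullback_annihilator D x
         (fun c w => flat (X x) c w - dfun H x c w
                     + (H x + reeb H c x) * contact_form x c w))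
    (X_tangent : forall x, M x -> tangent_to M (X x))
    (J : set R) (J_open : open J) (J_itv : is_interval J)
    (xi : R -> phase Q)
    (xi_M : forall t, J t -> M (xi t))
    (xi_int : integral_curve X J xi)
    (W : set Q) (Phi : 'I_k -> forall q : Q, covec q)
    (Phi_frame : annihilator_frame D W Phi) :
  exists lambda : R -> 'I_k -> R,
    forall t, J t -> W (base (xi t)) ->
    forall c, chart_at (atlas Q) (base (xi t)) c ->
    let q s i := (chart_coord (canonical_chart c) (xi s)).1.1 0 i in
    let p s i := (chart_coord (canonical_chart c) (xi s)).1.2 0 i in
    let z s := (chart_coord (canonical_chart c) (xi s)).2 in
    let dH e := pderiv H e (canonical_chart c) (xi t) in
    [/\ forall i, is_derive t 1 (q^~ i) (dH (Dp R i)),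
        forall i, is_derive t 1 (p^~ i)
          (- dH (Dq R i) - p t i * dH (Dz R n)
           - \sum_a lambda t a * Phi a (base (xi t)) c 0 i),
        is_derive t 1 z (\sum_i p t i * dH (Dp R i) - H (xi t)) &
        forall (s : nat) (U : set (phase Q)) (phi : 'I_s -> phase Q -> R),
          constraint_functions (phase_atlas Q) M U phi ->
          U (xi t) -> forall a, phi a (xi t) = 0].
Proof.
have mult t : exists mu : 'I_k -> R, J t -> W (base (xi t)) ->
    forall c, chart_at (atlas Q) (base (xi t)) c ->
    forall v, flat (X (xi t)) (canonical_chart c) v
      - dfun H (xi t) (canonical_chart c) v
      + (H (xi t) + reeb H (canonical_chart c) (xi t))
        * contact_form (xi t) (canonical_chart c) v
      = pairing (\sum_a mu a *: Phi a (base (xi t)) c) v.1.1.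
  (* Choice needs multipliers at every time: 0 outside J, or where the base
     point leaves W. *)
  have [[Jt Wt]|nJW] := pselect (J t /\ W (base (xi t))); last first.
    by exists (fun=> 0) => Jt Wt; case: nJW.
  have [alpha alphaD alphaE] := X_eq _ (xi_M t Jt).
  have [_ _ _ gen] := Phi_frame.
  have [mu muE] := (gen _ Wt alpha).1 alphaD.
  by exists mu => _ _ c ct v; rewrite alphaE // muE.
have [lambda lambdaP] := choice mult.
exists lambda => t Jt Wt c ct q p z dH.
have [qE pE zE] := herglotz_components H_smooth ct (lambdaP t Jt Wt c ct).
have e_at : chart_at (phase_atlas Q) (xi t) (canonical_chart c).
  by case: ct => Ac ct; split => //; exists c.
have [_ xi_der] := xi_int t Jt _ e_at.
split.
- move=> i; rewrite /dH -qE.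
  by apply/is_derive_entry/is_derive_fst/is_derive_fst.
- move=> i; have -> : \sum_a lambda t a * Phi a (base (xi t)) c 0 i =
      (\sum_a lambda t a *: Phi a (base (xi t)) c) 0 i.
    by rewrite summxE; apply: eq_bigr => a _; rewrite mxE.
  by rewrite /dH -pE; apply/is_derive_entry/is_derive_snd/is_derive_fst.
- by rewrite /dH -zE; apply/is_derive_snd.
- by move=> s U phi [_ _ UM] Ut a; apply/(UM _ Ut).1/xi_M.
Qed.
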